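(* Let $X$ be a real normed space, let $C\subseteq X$ be a convex cone with a finite basis $\{e_1,\dots,e_n\}$, and let $B$ be a bounded subset of $C$. Let $\{\varphi^t:C\rightarrow cc(C)\}_{t\geq0}$ be an iteration semigroup of sublinear correspondences satisfying: (i) $\varphi^0(x)=\{x\}$ for all $x\in C$; (ii) $\lim_{t\to0}\|\varphi^t-\varphi^0\|=0$. Then there exist $\beta_0>0$ and $\gamma>0$ such that $\|\varphi^t\|\leq\beta_0e^{\gamma t}$ for each $t\geq0$, and $$\forall w\geq0\ \ \forall\varepsilon>0\ \ \exists\delta>0\ \ \forall x\in B\ \ \forall s\ge 0\ \left(|s-w|<\delta\Rightarrow\mathfrak{h}(\widehat{\varphi^{w}}(x),\widehat{\varphi^s}(x))<\varepsilon\right).$$ In particular, the family $\{\widehat{\varphi^{t}}:t\geq0\}$ is continuous, i.e. for every $x\in C$ the map $t\mapsto\widehat{\varphi^t}(x)$ is continuous. Here $\widehat{\varphi^t}(x)=\sum_{j=1}^n\lambda_j\,\overline{co}(\varphi^t(e_j))$ for $x=\sum_{j=1}^n\lambda_je_j\in C$.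
   Context: A subset $C$ of a real normed space $X$ is a cone if $tC\subseteq C$ for every $t>0$. A linearly independent set $E$ is a basis of the cone $C$ if $C$ is exactly the set of all finite combinations $\lambda_1e_1+\dots+\lambda_ne_n$ with $e_i\in E$ and $\lambda_i\ge 0$. $cc(C)$ is the set of all nonempty compact convex subsets of $C$; $\varphi:C\to cc(C)$ denotes a correspondence (set-valued map) with values $\varphi(x)\in cc(C)$. It is sublinear if $\varphi(x+y)\subseteq\varphi(x)+\varphi(y)$ and $\varphi(\lambda x)=\lambda\varphi(x)$ for all $x,y\in C$, $\lambda>0$. Composition is $\psi\circ\varphi(x)=\bigcup_{y\in\varphi(x)}\psi(y)$. A family $\{\varphi^t:t\ge0\}$ of correspondences on $C$ is an iteration semigroup if $\varphi^t\circ\varphi^s=\varphi^{t+s}$ for all $t,s\ge0$. For a correspondence $\varphi$ put $\|\varphi(x)\|:=\sup\{\|y\|:y\in\varphi(x)\}$ and $\|\varphi\|=\inf\{M>0:\|\varphi(x)\|\le M\|x\|\text{ for all }x\in C\}$; $\|\varphi^t-\varphi^0\|$ is this norm of the correspondence $x\mapsto\varphi^t(x)-\varphi^0(x)=\{y-x:y\in\varphi^t(x)\}$. $\overline{co}$ is the closed convex hull. $\mathfrak{h}$ is the Hausdorff metric on nonempty compact sets, $\mathfrak{h}(A,B)=\max\{\sup_{a\in A}d(a,B),\sup_{b\in B}d(b,A)\}$; for compact-valued maps, continuity (upper and lower semicontinuity) is equivalent to continuity with respect to $\mathfrak{h}$. *)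

(* Defs.v *)
From HB Require Import structures.
From mathcomp Require Import all_boot all_order all_algebra.
From mathcomp Require Import all_classical all_reals all_analysis.

Set Implicit Arguments.
Unset Strict Implicit.
Unset Printing Implicit Defensive.

Import Order.TTheory GRing.Theory Num.Theory.
Import numFieldNormedType.Exports.

Local Open Scope classical_set_scope.
Local Open Scope ring_scope.

Section Cones.
Context {R : realType} {X : normedModType R}.
Implicit Types (C A B : set X).

Definition is_cone C : Prop :=
  forall (t : R) (x : X), 0 < t -> C x -> C (t *: x).

Definition lin_indep (n : nat) (e : 'I_n -> X) : Prop :=
  forall l : 'I_n -> R, \sum_(j < n) l j *: e j = 0 -> forall j, l j = 0.

(* [l] is a system of nonnegative coordinates of [x] in [e]. *)
Definition cone_coord (n : nat) (e : 'I_n -> X) (x : X) (l : 'I_n -> R) : Prop :=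
  (forall j, 0 <= l j) /\ x = \sum_(j < n) l j *: e j.

(* A combination of some of the [e j] is one of all of them, with zero
   coefficients on the others. *)
Definition cone_basis (n : nat) (e : 'I_n -> X) C : Prop :=
  lin_indep e /\ C = [set x | exists l, cone_coord e x l].

Definition cc C : set (set X) :=
  [set A | [/\ A !=set0, compact A, convex_set (A : set (convex_lmodType X))
             & A `<=` C]].

Definition mink_add A B : set X := [set a + b | a in A & b in B].

Definition mink_scale (l : R) A : set X := [set l *: a | a in A].

Definition closed_co A : set X :=
  smallest [set S : set X | closed S /\
                            convex_set (S : set (convex_lmodType X))] A.

Lemma edist_norm (x y : X) : edist (x, y) = `|x - y|%:E.
Proof.
apply/eqP; rewrite eq_le; apply/andP; split.
  apply/lee_addgt0Pr => r r0; rewrite -EFinD; apply: edist_fin.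
    by rewrite ltr_wpDl.
  by rewrite -ball_normE /= ltrDl.
apply: le_ereal_inf_tmp => z [r [r0]]; rewrite -ball_normE /= => h <-.
by rewrite lee_fin ltW.
Qed.

Definition hausdorff_dist A B : \bar R :=
  maxe (ereal_sup [set edist_inf B a | a in A])
       (ereal_sup [set edist_inf A b | b in B]).

End Cones.

(* A correspondence on [C] is a map [X -> set X] of which only the values on
   [C] matter. *)
Section Correspondences.
Context {R : realType} {X : normedModType R}.
Variable C : set X.
Implicit Types phi psi : X -> set X.

Definition cc_valued phi : Prop := forall x, C x -> cc C (phi x).

Definition sublinear phi : Prop :=
  (forall x y, C x -> C y -> phi (x + y) `<=` mink_add (phi x) (phi y)) /\
  (forall (l : R) x, 0 < l -> C x -> phi (l *: x) = mink_scale l (phi x)).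

Definition corr_comp psi phi : X -> set X :=
  fun x => \bigcup_(y in phi x) psi y.

Definition corr_sub phi psi : X -> set X :=
  fun x => [set y - z | y in phi x & z in psi x].

Definition set_norm (A : set X) : \bar R := ereal_sup [set `|y|%:E | y in A].

(* Equal to [+oo] when no bound [M] exists. *)
Definition corr_norm phi : \bar R :=
  ereal_inf [set M%:E | M in
    [set M : R | 0 < M /\
       forall x, C x -> (set_norm (phi x) <= (M * `|x|)%:E)%E]].

(* Only the members of the family with index [t >= 0] matter. *)
Definition iteration_semigroup (phi : R -> X -> set X) : Prop :=
  forall t s : R, 0 <= t -> 0 <= s ->
    forall x, C x -> corr_comp (phi t) (phi s) x = phi (t + s) x.

End Correspondences.

(* The Minkowski sum of the [l j]-multiples of the closed convex hulls of the
   [phi (e j)], where [l] is the coordinate vector of [x]. When [e] is a cone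
   basis of [C], exactly one [l] occurs in the union for [x] in [C]. *)
Definition corr_hat {R : realType} {X : normedModType R} (n : nat)
    (e : 'I_n -> X) (phi : X -> set X) : X -> set X :=
  fun x => \bigcup_(l in cone_coord e x)
    \big[mink_add/[set 0]]_(j < n) mink_scale (l j) (closed_co (phi (e j))).

Section SetValuedContinuity.
Context {T Y : topologicalType}.

Definition upper_semicontinuous_on (D : set T) (F : T -> set Y) : Prop :=
  forall t, D t -> forall V : set Y, open V -> F t `<=` V ->
    \forall s \near within D (nbhs t), F s `<=` V.

Definition lower_semicontinuous_on (D : set T) (F : T -> set Y) : Prop :=
  forall t, D t -> forall V : set Y, open V -> F t `&` V !=set0 ->
    \forall s \near within D (nbhs t), F s `&` V !=set0.

Definition corr_continuous_on (D : set T) (F : T -> set Y) : Prop :=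
  upper_semicontinuous_on D F /\ lower_semicontinuous_on D F.

End SetValuedContinuity.

(* Main.v *)
Require Import Defs.
From HB Require Import structures.
From mathcomp Require Import all_boot all_order all_algebra.
From mathcomp Require Import all_classical all_reals all_analysis.
From mathcomp Require Import lra.

(** Everything rests on the semigroup law read as: the points of
    [phi (u + s) x] are exactly those of the sets [phi u y], for [y] in
    [phi s x].  Hypothesis (ii), together with [phi 0 y = {y}], says that for
    small [u] every point of [phi u y] lies within [eta * |y|] of [y], with
    the same [eta] for all [y] in the cone ([semigroup_displacement]).

    Exponential growth ([semigroup_exp_growth]): with [eta = 1] a short step
    multiplies norms by at most [2 <= expR 1], and an interval of length [t] is
    covered by a number of short steps that is affine in [t].

    Continuity in time ([semigroup_equicontinuous]): for [s <= t], each point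
    of [phi t x] comes from some [y] in [phi s x] by a step of length [t - s],
    and each [y] in [phi s x] has, because [phi (t - s) y] is nonempty,
    a descendant in [phi t x].  In both directions the distance is at most
    [eta * |y|], and [|y|] is bounded by the growth estimate, uniformly for
    times in a bounded interval.

    Passage to the linearized maps ([corr_hat_excess]): the closed convex hulls
    change nothing, as the values are already compact and convex, and Minkowski
    combinations add up the distances with the coordinates as weights.  The
    coordinates of [x] are at most a constant times [|x|], because the [e j]
    are linearly independent and finitely many ([lin_indep_coord_bound]).  This
    is where boundedness of [B] gives a [delta] independent of [x].

    Semicontinuity in the topological sense then follows, as the sets in play
    are compact and a compact subset of an open set has a uniform margin in it
    ([corr_continuous_on_excess]). *)

Set Implicit Arguments.
Unset Strict Implicit.
Unset Printing Implicit Defensive.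

Import Order.TTheory GRing.Theory Num.Theory.
Import numFieldNormedType.Exports.

Local Open Scope classical_set_scope.
Local Open Scope ring_scope.

(** * One-sided Hausdorff bounds and Minkowski operations *)

Section Excess.
Context {R : realType} {X : normedModType R}.
Implicit Types (A B : set X) (r c : R).

(** The one-sided half of a Hausdorff estimate.  It asks for a witness in [B]
    instead of a bound on an infimum, so it adds up along Minkowski sums without
    any attainment argument. *)
Definition excess_le r A B : Prop :=
  forall a, A a -> exists2 b, B b & `|a - b| <= r.

Lemma excess_leW r c A B : r <= c -> excess_le r A B -> excess_le c A B.
Proof.
move=> rc AB a /AB[b Bb abr]; exists b => //; exact: le_trans rc.
Qed.

Lemma hausdorff_dist_le r A B :
  excess_le r A B -> excess_le r B A -> (hausdorff_dist A B <= r%:E)%E.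
Proof.
move=> AB BA; rewrite /hausdorff_dist ge_max; apply/andP; split;
  apply: ge_ereal_sup => _ [a Aa <-].
- have [b Bb abr] := AB _ Aa; rewrite /edist_inf.
  apply: ge_ereal_inf; exists (edist (a, b)); first by exists b.
  by rewrite edist_norm lee_fin.
- have [b Bb abr] := BA _ Aa; rewrite /edist_inf.
  apply: ge_ereal_inf; exists (edist (a, b)); first by exists b.
  by rewrite edist_norm lee_fin.
Qed.

Lemma excess_le_scale l r A B :
  0 <= l -> excess_le r A B -> excess_le (l * r) (mink_scale l A) (mink_scale l B).
Proof.
move=> l0 AB _ [a Aa <-]; have [b Bb abr] := AB _ Aa.
by exists (l *: b); [exists b|rewrite -scalerBr normrZ ger0_norm// ler_wpM2l].
Qed.

Lemma excess_le_add r c A A' B B' :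
  excess_le r A B -> excess_le c A' B' ->
  excess_le (r + c) (mink_add A A') (mink_add B B').
Proof.
move=> AB AB' _ [a Aa [a' Aa' <-]].
have [b Bb abr] := AB _ Aa; have [b' Bb' abr'] := AB' _ Aa'.
exists (b + b'); first by exists b => //; exists b'.
by rewrite opprD addrACA (le_trans (ler_normD _ _))// lerD.
Qed.

Lemma excess_le_sum (I : finType) (r : I -> R) (A B : I -> set X) :
  (forall i, excess_le (r i) (A i) (B i)) ->
  excess_le (\sum_i r i) (\big[mink_add/[set 0]]_i A i)
    (\big[mink_add/[set 0]]_i B i).
Proof.
move=> AB; apply: (big_rec3 (fun a b c => excess_le c a b)).
  by move=> _ ->; exists 0 => //; rewrite subrr normr0.
by move=> i a b c _; exact: excess_le_add.
Qed.

Lemma compact_mink_scale l A : compact A -> compact (mink_scale l A).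
Proof.
move=> cA; apply: continuous_compact => //.
by apply: continuous_subspaceT => x; exact: scaler_continuous.
Qed.

Lemma compact_mink_add A B : compact A -> compact B -> compact (mink_add A B).
Proof.
move=> cA cB.
have -> : mink_add A B = (fun z : X * X => z.1 + z.2) @` (A `*` B).
  apply/seteqP; split=> [_ [a Aa [b Bb <-]]|_ [[a b] [/= Aa Bb] <-]].
    by exists (a, b).
  by exists a => //; exists b.
apply: continuous_compact; last exact: compact_setX.
by apply: continuous_subspaceT => x; exact: add_continuous.
Qed.

Lemma compact_mink_sum (I : finType) (A : I -> set X) :
  (forall i, compact (A i)) -> compact (\big[mink_add/[set 0]]_i A i).
Proof.
move=> cA; apply: big_ind => //; first exact: compact_set1.
exact: compact_mink_add.
Qed.

(** Identifies the hulls [closed_co (phi (e j))] that occur in [corr_hat] with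
    [phi (e j)]. *)
Lemma closed_co_id (A : set X) : compact A ->
  convex_set (A : set (convex_lmodType X)) -> closed_co A = A.
Proof.
move=> cA vA; apply: smallest_id; split=> //.
by apply: compact_closed => //; exact: norm_hausdorff.
Qed.

(** * From Hausdorff continuity to semicontinuity *)

(** The Lebesgue number of the one-set cover: the radii that work near a given
    point of [K] contain an interval [(0, d/2)], and compactness makes the
    choice uniform. *)
Lemma compact_sub_open_ball (K V : set X) : compact K -> open V -> K `<=` V ->
  exists2 r : R, 0 < r & forall a, K a -> ball a r `<=` V.
Proof.
move=> /compact_near_coveringP cK oV KV.
have /cK : forall a, K a -> \forall b \near a & r \near 0^'+, ball b (r : R) `<=` V.
  move=> a Ka; have /nbhs_ballP[d /= d0 adV] : nbhs a V.
    by apply: open_nbhs_nbhs; split => //; exact: KV.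
  exists (ball a (d / 2), [set r | 0 < r < d / 2]) => /=.
    split; first by apply: nbhsx_ballx; rewrite divr_gt0.
    near=> r; apply/andP; split; near: r; first exact: nbhs_right_gt.
    by apply: nbhs_right_lt; rewrite divr_gt0.
  move=> [b r] [/= ab /andP[r0 rd]] c bc; apply: adV.
  rewrite [d]splitr; apply: ball_triangle ab _; exact: le_ball (ltW rd) _ bc.
move=> near0; near (0 : R)^'+ => r; exists r.
  by near: r; exact: nbhs_right_gt.
by near: r; exact: near0.
Unshelve. all: by end_near.
Qed.

(** Upper semicontinuity comes from the uniform margin of a compact value inside
    [V], lower semicontinuity from the ball around a single point of [V]. *)
Lemma corr_continuous_on_excess (D : set R) (F : R -> set X) :
  (forall t, D t -> compact (F t)) ->
  (forall t, D t -> forall eps : R, 0 < eps -> exists2 d : R, 0 < d &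
    forall s, D s -> `|s - t| < d ->
      excess_le eps (F t) (F s) /\ excess_le eps (F s) (F t)) ->
  corr_continuous_on D F.
Proof.
move=> cF eF; split=> t Dt V oV.
- move=> FV; have [r r0 rV] := compact_sub_open_ball (cF _ Dt) oV FV.
  have [d d0 dF] := eF _ Dt (r / 2) (divr_gt0 r0 (ltr0Sn _ _)).
  apply/nbhs_ballP; exists d => // s; rewrite -ball_normE /= distrC => sd Ds b Fb.
  have [a Fa ba] := (dF s Ds sd).2 b Fb; apply: (rV a Fa).
  rewrite -ball_normE /= distrC (le_lt_trans ba)//; lra.
- move=> [a [Fa Va]].
  have /nbhs_ballP[r /= r0 rV] : nbhs a V by exact: open_nbhs_nbhs.
  have [d d0 dF] := eF _ Dt (r / 2) (divr_gt0 r0 (ltr0Sn _ _)).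
  apply/nbhs_ballP; exists d => // s; rewrite -ball_normE /= distrC => sd Ds.
  have [b Fb ab] := (dF s Ds sd).1 a Fa; exists b; split => //; apply: rV.
  rewrite -ball_normE /= (le_lt_trans ab)//; lra.
Qed.

End Excess.

(** * Coordinates in a finite basis *)

Section Coordinates.
Context {R : realType} {X : normedModType R}.
Variables (n : nat) (e : 'I_n -> X).

(** The norm of a combination is a continuous function of its coefficients and
    vanishes nowhere on the compact unit sphere of the sum norm; the inverse of
    its minimum there is a suitable [K], and homogeneity removes the
    normalization. *)
Lemma lin_indep_coord_bound : lin_indep e -> exists2 K : R, 0 < K &
  forall l : 'I_n -> R, \sum_j `|l j| <= K * `|\sum_j l j *: e j|.
Proof.
move=> indep.
pose g (v : 'rV[R]_n) := \sum_j `|v ord0 j|.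
pose f (v : 'rV[R]_n) := `|\sum_j v ord0 j *: e j|.
have cg : continuous g.
  apply: (@continuous_big R _ +%R 0 xpredT); first exact: add_continuous.
  move=> j _ v; apply: continuous_comp; first exact: coord_continuous.
  exact: norm_continuous.
have cf : continuous f.
  move=> v; apply: (@continuous_comp _ _ _
    (fun v : 'rV[R]_n => \sum_j v ord0 j *: e j) Num.norm).
    apply: (@continuous_big X _ +%R 0 xpredT); first exact: add_continuous.
    move=> j _ {}v; apply: (@continuous_comp _ _ _
      (fun v : 'rV[R]_n => v ord0 j) (fun t : R => t *: e j)).
      exact: coord_continuous.
    exact: scalel_continuous.
  exact: norm_continuous.
pose S := g @^-1` [set 1].
have cS : compact S.
  apply: bounded_closed_compact; last first.
    by apply: closed_comp; [move=> v _; exact: cg|exact: closed_eq].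
  exists 1; split => // M M1 v Sv; apply/(le_trans _ (ltW M1)).
  rewrite /Num.norm /= mx_normrE; apply/bigmax_leP; split => // -[i j] _ /=.
  rewrite ord1 -Sv /g (bigD1 j)//= lerDl; exact: sumr_ge0.
have homog (l : 'I_n -> R) : 0 < \sum_j `|l j| ->
    S (\row_j (l j / \sum_j `|l j|)) /\
    f (\row_j (l j / \sum_j `|l j|)) = `|\sum_j l j *: e j| / \sum_j `|l j|.
  set s := \sum_j _ => s0; split.
    rewrite /S /= /g; under eq_bigr do rewrite mxE normrM normfV (gtr0_norm s0).
    by rewrite -mulr_suml divff// gt_eqF.
  rewrite /f; under eq_bigr do rewrite mxE mulrC -scalerA.
  by rewrite -scaler_sumr normrZ normfV (gtr0_norm s0) mulrC.
(* The sphere is empty exactly when [n = 0]. *)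
have [S0|S0] := eqVneq S set0.
  exists 1 => // l; have : 0 <= \sum_j `|l j| by exact: sumr_ge0.
  rewrite le_eqVlt => /predU1P[<-|/homog[+ _]]; first by rewrite mul1r.
  by rewrite S0.
have [c /set_mem Sc cmin] : exists2 c, c \in S & forall v, v \in S -> f c <= f v.
    by apply: compact_EVT_min => //; [exact/set0P|exact: continuous_subspaceT].
  have fc0 : 0 < f c.
    rewrite normr_gt0; apply/eqP => /(indep (c ord0)) c0.
    move: Sc; rewrite /S /= /g big1 => [/eqP|j _]; first by rewrite eq_sym oner_eq0.
    by rewrite c0 normr0.
  exists (f c)^-1 => [|l]; first by rewrite invr_gt0.
  have : 0 <= \sum_j `|l j| by exact: sumr_ge0.
  rewrite le_eqVlt => /predU1P[<-|s0]; first by rewrite mulr_ge0// invr_ge0 ltW.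
  have [Sl fl] := homog l s0.
  have := cmin _ (mem_set Sl).
  by rewrite fl ler_pdivlMr// ler_pdivlMl.
Qed.

Lemma cone_basis_mem C j : cone_basis e C -> C (e j).
Proof.
move=> [_ ->]; exists (fun i => (i == j)%:R); split => [i|]; first exact: ler0n.
rewrite (bigD1 j)//= eqxx scale1r big1 ?addr0// => i /negPf ->.
by rewrite scale0r.
Qed.

Lemma cone_coord_uniq x l k :
  lin_indep e -> cone_coord e x l -> cone_coord e x k -> l = k.
Proof.
move=> indep [_ xl] [_ xk]; apply/funext => j; apply/eqP; rewrite -subr_eq0.
apply/eqP; apply: (indep (fun j => l j - k j)).
under eq_bigr do rewrite scalerBl.
by rewrite sumrB -xl -xk subrr.
Qed.

End Coordinates.

(** * Growth and equicontinuity of the semigroup *)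

Section CorrespondenceNorm.
Context {R : realType} {X : normedModType R}.
Variable C : set X.
Implicit Type phi : X -> set X.

(** The inequality is strict because [corr_norm] is an infimum, which need not
    be one of the bounds that it ranges over. *)
Lemma corr_norm_lt_bound phi (r : R) : (corr_norm C phi < r%:E)%E ->
  forall x y, C x -> phi x y -> `|y| <= r * `|x|.
Proof.
move=> /ereal_inf_lt[_ [M [M0 phiM] <-]]; rewrite lte_fin => Mr x y Cx xy.
rewrite -lee_fin; apply: (@le_trans _ _ (M * `|x|)%:E); last first.
  by rewrite lee_fin ler_wpM2r// ltW.
by apply: le_trans (phiM x Cx); apply: ereal_sup_ubound; exists y.
Qed.

Lemma bound_corr_norm_le phi (M : R) : 0 < M ->
  (forall x y, C x -> phi x y -> `|y| <= M * `|x|) -> (corr_norm C phi <= M%:E)%E.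
Proof.
move=> M0 phiM; apply: ereal_inf_lbound; exists M => //; split => // x Cx.
by apply: ge_ereal_sup => _ [y xy <-]; rewrite lee_fin phiM.
Qed.

End CorrespondenceNorm.

Section Semigroup.
Context {R : realType} {X : normedModType R}.
Variables (C : set X) (phi : R -> X -> set X).
Hypothesis phi_cc : forall t, 0 <= t -> cc_valued C (phi t).
Hypothesis phiD : iteration_semigroup C phi.
Hypothesis phi0 : forall x, C x -> phi 0 x = [set x].
Hypothesis phi_cvg0 : corr_norm C (corr_sub (phi t) (phi 0)) @[t --> 0^'+] --> 0%E.

Let phi_mem t x y : 0 <= t -> C x -> phi t x y -> C y.
Proof. by move=> t0 Cx; have [_ _ _] := phi_cc t0 Cx; exact. Qed.

(** Subtracting [phi 0 x = {x}] turns the norm in the hypothesis into a bound on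
    the displacement [y - x]; at [t = 0] the displacement is zero. *)
Lemma semigroup_displacement (eta : R) : 0 < eta -> exists2 d : R, 0 < d &
  forall t, 0 <= t -> t < d -> forall x y, C x -> phi t x y ->
    `|y - x| <= eta * `|x|.
Proof.
move=> eta0.
have : nbhs (0%E : \bar R) [set z | (z < eta%:E)%E].
  by apply: open_nbhs_nbhs; split; [exact: open_ereal_lt_ereal|rewrite /= lte_fin].
move=> /phi_cvg0 /nbhs_ballP[d /= d0 dphi]; exists d => // t.
rewrite le_eqVlt => /predU1P[<- _ x y Cx|t0 td x y Cx xy].
  by rewrite phi0// => ->; rewrite subrr normr0 mulr_ge0// ltW.
have /dphi /(_ t0) small : ball 0 d t by rewrite /ball /= sub0r normrN gtr0_norm.
apply: (corr_norm_lt_bound small Cx).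
by exists y => //; exists x => //; rewrite phi0.
Qed.

(** If times below [d] at most double norms, then cutting [0, t] into pieces of
    length [d / 2] costs a factor [expR 1] per piece, and at most
    [1 + t / (d / 2)] pieces are needed; hence the exponent [(d / 2)^-1] and the
    extra factor [expR 1]. *)
Lemma semigroup_exp_growth : exists gamma : R, 0 < gamma /\
  forall t, 0 <= t -> forall x y, C x -> phi t x y ->
    `|y| <= expR 1 * expR (gamma * t) * `|x|.
Proof.
have [d d0 dphi] := semigroup_displacement ltr01.
have short t : 0 <= t -> t < d -> forall x y, C x -> phi t x y ->
    `|y| <= expR 1 * `|x|.
  move=> t0 td x y Cx xy; have yx := dphi t t0 td x y Cx xy.
  have := ler_normD (y - x) x; rewrite subrK => /le_trans; apply.
  apply: (@le_trans _ _ ((1 + 1) * `|x|)); first by rewrite mulrDl mul1r; lra.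
  by apply: ler_wpM2r => //; exact: expR_ge1Dx.
have steps k t : 0 <= t -> t < k.+1%:R * (d / 2) -> forall x y, C x ->
    phi t x y -> `|y| <= expR k.+1%:R * `|x|.
  elim: k t => [|k IHk] t t0 tk x z Cx xz.
    by apply: (short t) => //; lra.
  (* The last piece has length [d / 2], or all of [t] if that is shorter;
     either way its length stays strictly below [d]. *)
  have [s [s0 ts sk]] : exists s,
      [/\ 0 <= s, 0 <= t - s < d & s < k.+1%:R * (d / 2)].
    have [dt|td] := leP (d / 2) t.
      exists (t - d / 2); rewrite subr_ge0 opprB addrC subrK; split => //.
        by apply/andP; split; lra.
      by rewrite ltrBlDr -[X in _ + X]mul1r -mulrDl natr1.
    exists 0; rewrite subr0 t0 /=; split => //; first lra.
    by rewrite mulr_gt0// divr_gt0.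
  have /andP[ts0 tsd] := ts.
  move: xz; rewrite -(subrK s t) -phiD// => -[y xy yz].
  have zy := short (t - s) ts0 tsd y z (phi_mem s0 Cx xy) yz.
  rewrite (le_trans zy)// -natr1 addrC expRD -mulrA ler_wpM2l ?expR_ge0//.
  exact: (IHk s).
exists (d / 2)^-1; split; first by rewrite invr_gt0 divr_gt0.
move=> t t0 x y Cx xy.
have d20 : 0 < d / 2 by rewrite divr_gt0.
have td0 : 0 <= t / (d / 2) by rewrite divr_ge0// ltW.
have /andP[kt tk] := truncn_itv td0.
rewrite ltr_pdivrMr// in tk.
apply: (le_trans (steps _ t t0 tk x y Cx xy)).
rewrite -expRD ler_wpM2r// ler_expR -natr1 addrC lerD2l.
by rewrite [leRHS]mulrC.
Qed.

(** The points of [phi (u + s) x] are the descendants of those of [phi s x], so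
    following a point forward or backward over the time [u] gives the two
    estimates. *)
Lemma excess_le_step (s u eta M : R) x : 0 <= s -> 0 <= u -> C x ->
  0 <= eta -> (forall y, phi s x y -> `|y| <= M) ->
  (forall y z, C y -> phi u y z -> `|z - y| <= eta * `|y|) ->
  excess_le (eta * M) (phi s x) (phi (u + s) x) /\
  excess_le (eta * M) (phi (u + s) x) (phi s x).
Proof.
move=> s0 u0 Cx eta0 sM ueta; rewrite -phiD//; split.
- move=> y xy; have Cy := phi_mem s0 Cx xy.
  have [[z yz] _ _ _] := phi_cc u0 Cy.
  exists z; first by exists y.
  by rewrite distrC (le_trans (ueta y z Cy yz))// ler_wpM2l// sM.
- move=> z [y xy yz]; exists y => //.
  by rewrite (le_trans (ueta y z (phi_mem s0 Cx xy) yz))// ler_wpM2l// sM.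
Qed.

(** The modulus of continuity depends only on the horizon [T]: the displacement
    bound is applied at points whose norm the growth estimate bounds by
    [M * |x|], which explains the choice [eta = eps / M]. *)
Lemma semigroup_equicontinuous (T eps : R) : 0 <= T -> 0 < eps ->
  exists2 d : R, 0 < d & forall s t, 0 <= s <= T -> 0 <= t <= T ->
    `|s - t| < d -> forall x, C x -> excess_le (eps * `|x|) (phi s x) (phi t x).
Proof.
move=> T0 eps0; have [gamma [gamma0 growth]] := semigroup_exp_growth.
set M := expR 1 * expR (gamma * T).
have M0 : 0 < M by rewrite mulr_gt0// expR_gt0.
have [d d0 dphi] := semigroup_displacement (divr_gt0 eps0 M0).
have growthT s x y : 0 <= s <= T -> C x -> phi s x y -> `|y| <= M * `|x|.
  move=> /andP[s0 sT] Cx xy; rewrite (le_trans (growth s s0 x y Cx xy))//.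
  by rewrite ler_wpM2r// ler_wpM2l ?expR_ge0// ler_expR ler_wpM2l// ltW.
have step s t x : 0 <= s <= T -> s <= t -> t - s < d -> C x ->
    excess_le (eps * `|x|) (phi s x) (phi t x) /\
    excess_le (eps * `|x|) (phi t x) (phi s x).
  move=> sT st td Cx; have /andP[s0 _] := sT.
  have ts0 : 0 <= t - s by rewrite subr_ge0.
  have eM0 : 0 <= eps / M by rewrite divr_ge0// ltW.
  have := excess_le_step s0 ts0 Cx eM0 (fun y => growthT s x y sT Cx)
    (dphi (t - s) ts0 td).
  by rewrite subrK mulrA divfK ?gt_eqF.
exists d => // s t sT tT std x Cx; have [st|/ltW ts] := leP s t.
  by apply: (step s t x sT st _ Cx).1; rewrite distrC ger0_norm ?subr_ge0 in std.
by apply: (step t s x tT ts _ Cx).2; rewrite ger0_norm ?subr_ge0 in std.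
Qed.

End Semigroup.

(** * The linearized correspondences *)

Section Hat.
Context {R : realType} {X : normedModType R}.
Variables (C : set X) (n : nat) (e : 'I_n -> X).
Hypothesis e_basis : cone_basis e C.
Implicit Type phi psi : X -> set X.

(** Linearization is Lipschitz from correspondences to correspondences: with
    coordinates [l] of [x], the excess is at most
    [\sum_j l j * r * |e j|], and the sum of the [l j] is at most a constant times [|x|]. *)
Lemma corr_hat_excess : exists2 L : R, 0 < L &
  forall phi psi (r : R), cc_valued C phi -> cc_valued C psi -> 0 <= r ->
    (forall x, C x -> excess_le (r * `|x|) (phi x) (psi x)) ->
    forall x, excess_le (L * r * `|x|) (corr_hat e phi x) (corr_hat e psi x).
Proof.
have [K K0 coordK] := lin_indep_coord_bound e_basis.1.
(* The summand 1 keeps [E] positive when [n = 0]. *)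
pose E := 1 + \sum_j `|e j|.
have E0 : 0 < E by rewrite ltr_wpDr// sumr_ge0.
have eE j : `|e j| <= E.
  rewrite /E (bigD1 j)//= addrCA lerDl addr_ge0// sumr_ge0//.
exists (K * E); first by rewrite mulr_gt0.
move=> phi psi r ccphi ccpsi r0 ex x a [l [l0 xl] la].
have hull chi j : cc_valued C chi -> closed_co (chi (e j)) = chi (e j).
  move=> /(_ _ (cone_basis_mem j e_basis))[_ cchi vchi _]; exact: closed_co_id.
have scaled j : excess_le (l j * (r * `|e j|))
    (mink_scale (l j) (closed_co (phi (e j))))
    (mink_scale (l j) (closed_co (psi (e j)))).
  by apply: excess_le_scale => //; rewrite !hull//; apply: ex; exact: cone_basis_mem e_basis.
have [b lb ab] := excess_le_sum scaled la.
exists b; first by exists l.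
apply: (le_trans ab); apply: (@le_trans _ _ (\sum_j l j * (r * E))).
  by apply: ler_sum => j _; rewrite !ler_wpM2l.
rewrite -mulr_suml mulrC.
have -> : K * E * r * `|x| = r * E * (K * `|x|) by lra.
apply: ler_wpM2l; first by rewrite mulr_ge0// ltW.
apply: le_trans (_ : \sum_j `|l j| <= _); last by rewrite xl.
by apply: ler_sum => j _; exact: ler_norm.
Qed.

(** Uniqueness of coordinates reduces the union over coordinate systems in
    [corr_hat] to a single Minkowski sum of compact sets. *)
Lemma compact_corr_hat phi x : cc_valued C phi -> C x -> compact (corr_hat e phi x).
Proof.
move=> ccphi Cx; have [indep CE] := e_basis.
have [l lx] : exists l, cone_coord e x l by move: Cx; rewrite CE.
have -> : corr_hat e phi x =
    \big[mink_add/[set 0]]_(j < n) mink_scale (l j) (closed_co (phi (e j))).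
  apply/seteqP; split=> [y [k kx]|y ly]; last by exists l.
  by rewrite (cone_coord_uniq indep lx kx).
apply: compact_mink_sum => j; apply: compact_mink_scale.
by have [_ cphi vphi _] := ccphi _ (cone_basis_mem j e_basis); rewrite closed_co_id.
Qed.

End Hat.

Theorem theorem2 (R : realType) (X : normedModType R) (C : set X)
    (hcone : is_cone C) (hconv : convex_set (C : set (convex_lmodType X)))
    (n : nat) (e : 'I_n -> X) (hbasis : cone_basis e C)
    (B : set X) (hBC : B `<=` C) (hB : bounded_set B)
    (phi : R -> X -> set X)
    (hcc : forall t : R, 0 <= t -> cc_valued C (phi t))
    (hsemi : iteration_semigroup C phi)
    (hsub : forall t : R, 0 <= t -> sublinear C (phi t))
    (h0 : forall x : X, C x -> phi 0 x = [set x])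
    (hlim : corr_norm C (corr_sub (phi t) (phi 0)) @[t --> 0^'+] --> 0%E) :
  (exists beta0 gamma : R, [/\ 0 < beta0, 0 < gamma &
     forall t : R, 0 <= t ->
       (corr_norm C (phi t) <= (beta0 * expR (gamma * t))%:E)%E]) /\
  (forall w : R, 0 <= w -> forall eps : R, 0 < eps ->
     exists2 delta : R, 0 < delta &
       forall x : X, B x -> forall s : R, 0 <= s -> `|s - w| < delta ->
         (hausdorff_dist (corr_hat e (phi w) x) (corr_hat e (phi s) x)
            < eps%:E)%E) /\
  (forall x : X, C x ->
     corr_continuous_on [set t : R | 0 <= t] (fun t => corr_hat e (phi t) x)).
Proof.
have [L L0 hatL] := corr_hat_excess hbasis.
have hat_close (D w eps : R) : 0 < D -> 0 <= w -> 0 < eps ->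
    exists2 d : R, 0 < d & forall s, 0 <= s -> `|s - w| < d ->
      forall x, `|x| <= D ->
        excess_le eps (corr_hat e (phi w) x) (corr_hat e (phi s) x) /\
        excess_le eps (corr_hat e (phi s) x) (corr_hat e (phi w) x).
  move=> D0 w0 eps0.
  have LD0 : 0 < L * D by rewrite mulr_gt0.
  have r0 := divr_gt0 eps0 LD0.
  (* Times within 1 of [w] stay below the horizon [w + 1]. *)
  have T0 : 0 <= w + 1 by rewrite addr_ge0.
  have [d d0 close] := semigroup_equicontinuous hcc hsemi h0 hlim T0 r0.
  exists (Num.min d 1) => [|s s0]; first by rewrite lt_min d0 ltr01.
  rewrite lt_min => /andP[sd s1] x xD.
  have wT : 0 <= w <= w + 1 by rewrite w0 lerDl ler01.
  have sT : 0 <= s <= w + 1.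
    by rewrite s0 -lerBlDl ltW// (le_lt_trans (ler_norm _)).
  have bound : L * (eps / (L * D)) * `|x| <= eps.
    rewrite -[leRHS](@divfK _ (L * D)) ?gt_eqF// mulrAC mulrC.
    by rewrite ler_wpM2l ?ler_wpM2l// ltW.
  split; apply: excess_leW bound _; apply: hatL => //; try exact: hcc;
    try exact: ltW.
  - by apply: close => //; rewrite distrC.
  - exact: close.
split.
  have [gamma [gamma0 growth]] := semigroup_exp_growth hcc hsemi h0 hlim.
  exists (expR 1), gamma; split; rewrite ?expR_gt0// => t t0.
  apply: bound_corr_norm_le (growth t t0).
  by rewrite mulr_gt0// expR_gt0.
split=> [w w0 eps eps0|x Cx].
  have [D [_ BD]] := hB.
  have D1 : D < `|D| + 1 by rewrite (le_lt_trans (ler_norm _))// ltrDl.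
  have [||d d0 close] := hat_close (`|D| + 1) w (eps / 2) _ w0 _.
  - by rewrite ltr_wpDl.
  - by rewrite divr_gt0.
  exists d => // x Bx s s0 sw.
  have [ws sw'] := close s s0 sw x (BD _ D1 x Bx).
  apply: (le_lt_trans (hausdorff_dist_le ws sw')).
  by rewrite lte_fin; lra.
apply: corr_continuous_on_excess => [t t0|t t0 eps eps0].
  exact: (compact_corr_hat hbasis (hcc t t0) Cx).
have [|d d0 close] := hat_close (`|x| + 1) t eps _ t0 eps0.
  by rewrite ltr_wpDl.
exists d => // s s0 st; apply: close => //.
by rewrite lerDl.
Qed.
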